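(* Let $\xi,\eta\in(\ell^1)^*$ and $\xi\prec_\infty\eta$. (i) $\xi\preccurlyeq_\infty\zeta\le\eta$ for some $\zeta\in \mathrm{c}_{\mathrm{o}}^*$. (ii) $\xi\le\rho\preccurlyeq_\infty\eta$ for some $\rho\in \mathrm{c}_{\mathrm{o}}^*$.
   Context: $\mathrm{c}_{\mathrm{o}}^*$ denotes the cone of nonnegative monotone nonincreasing sequences converging to $0$, and $(\ell^1)^*$ the subcone of summable ones (neither denotes a dual space). For $\xi,\eta\in(\ell^1)^*$: $\xi\prec_\infty\eta$ means $\sum_{j=n}^\infty\xi_j\le\sum_{j=n}^\infty\eta_j$ for every $n\in\mathbb N$; $\xi\preccurlyeq_\infty\eta$ means $\xi\prec_\infty\eta$ and $\sum_{j=1}^\infty\xi_j=\sum_{j=1}^\infty\eta_j$ (these relations are defined only between summable sequences). $\xi\le\eta$ means $\xi_n\le\eta_n$ for every $n$. *)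

(* Defs.v *)
From Stdlib Require Import Reals.
From Coquelicot Require Import Coquelicot.
Open Scope R_scope.

(* Stdlib real numbers with Coquelicot series.  Sequences are indexed from 0
   instead of 1: the n-th term in the usual notation is [xi (n - 1)]. *)

Definition co_star (xi : nat -> R) : Prop :=
  (forall n, 0 <= xi n) /\ Un_decreasing xi /\ is_lim_seq xi 0.

Definition l1_star (xi : nat -> R) : Prop := co_star xi /\ ex_series xi.

Definition tail_sum (xi : nat -> R) (n : nat) : R :=
  Series (fun j => xi (n + j)%nat).

(* The relations are only meaningful between summable sequences ([Series] is
   a total function with arbitrary values on divergent series), so membership
   in (l^1)* is part of the relation. *)
Definition prec_infty (xi eta : nat -> R) : Prop :=
  l1_star xi /\ l1_star eta /\ forall n, tail_sum xi n <= tail_sum eta n.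

Definition preceq_infty (xi eta : nat -> R) : Prop :=
  prec_infty xi eta /\ Series xi = Series eta.

Definition seq_le (xi eta : nat -> R) : Prop := forall n, xi n <= eta n.

(* Main.v *)
Require Import Defs.
From Stdlib Require Import Reals Lra Lia.
From Coquelicot Require Import Coquelicot.
Open Scope R_scope.

(** For (i), cut [eta] off at a height [c]: [zeta n = min (eta n) c], where [c]
    is chosen by the intermediate value theorem so that [zeta] has the sum of
    [xi].  Where [xi n >= c], the first [n] terms of [xi] dominate those of
    [zeta], so the tails compare the other way; where [eta n <= c], the tails of
    [zeta] and [eta] agree; in between, [xi n < c = zeta n], and the comparison
    propagates downwards from [n + 1] to [n].
    For (ii), add the whole defect [Series eta - Series xi] to the first term of
    [xi]. *)

(** * Tail sums and estimates by head and tail *)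

Lemma tail_sum_step (a : nat -> R) (n : nat) :
  ex_series a -> tail_sum a n = a n + tail_sum a (S n).
Proof.
  intros Ha. unfold tail_sum.
  rewrite Series_incr_1.
  - rewrite Nat.add_0_r. f_equal. apply Series_ext. intros j. f_equal. lia.
  - now apply (ex_series_incr_n a n).
Qed.

Lemma tail_sum_0 (a : nat -> R) : tail_sum a 0 = Series a.
Proof. reflexivity. Qed.

Lemma tail_sum_le (a b : nat -> R) (n : nat) :
  ex_series b -> (forall j, (n <= j)%nat -> 0 <= a j <= b j) ->
  tail_sum a n <= tail_sum b n.
Proof.
  intros Hb H. apply Series_le.
  - intros j. apply H. lia.
  - now apply (ex_series_incr_n b n).
Qed.

Lemma is_lim_tail_sum (a : nat -> R) :
  ex_series a -> is_lim_seq (tail_sum a) 0.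
Proof.
  intros Ha.
  (* [sum_n a n] includes the term of index [n], so it complements the tail from [S n]; hence the
     shift. *)
  apply is_lim_seq_incr_1.
  apply is_lim_seq_ext with (fun n => Series a - sum_n a n).
  - intros n. unfold tail_sum.
    rewrite (Series_incr_n a (S n)); [ | lia | exact Ha].
    simpl pred. rewrite sum_n_Reals. lra.
  - replace (Finite 0) with (Finite (Series a - Series a)) by (f_equal; lra).
    apply is_lim_seq_minus'.
    + apply is_lim_seq_const.
    + exact (Series_correct a Ha).
Qed.

(** Induction on [n]: each step moves one term from the tail to the head and bounds it by [c]. *)
Lemma Series_le_head_tail (a : nat -> R) (c : R) (n : nat) :
  ex_series a -> (forall j, (j < n)%nat -> a j <= c) ->
  Series a <= INR n * c + tail_sum a n.
Proof.
  intros Ha. induction n as [|n IH]; intros H.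
  - rewrite tail_sum_0. simpl. lra.
  - rewrite S_INR.
    pose proof (IH (fun j Hj => H j (Nat.lt_lt_succ_r _ _ Hj))) as IHn.
    rewrite (tail_sum_step a n Ha) in IHn.
    pose proof (H n (Nat.lt_succ_diag_r n)). lra.
Qed.

Lemma Series_ge_head_tail (a : nat -> R) (c : R) (n : nat) :
  ex_series a -> (forall j, (j < n)%nat -> c <= a j) ->
  INR n * c + tail_sum a n <= Series a.
Proof.
  intros Ha. induction n as [|n IH]; intros H.
  - rewrite tail_sum_0. simpl. lra.
  - rewrite S_INR.
    pose proof (IH (fun j Hj => H j (Nat.lt_lt_succ_r _ _ Hj))) as IHn.
    rewrite (tail_sum_step a n Ha) in IHn.
    pose proof (H n (Nat.lt_succ_diag_r n)). lra.
Qed.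

Lemma ex_series_le_pos (a b : nat -> R) :
  ex_series b -> (forall n, 0 <= a n <= b n) -> ex_series a.
Proof.
  intros Hb H. apply (ex_series_le a b); [|exact Hb].
  intros n. change (Rabs (a n) <= b n). rewrite Rabs_pos_eq; apply H.
Qed.

(** * Truncation at a height and its sum *)

(* The absolute value keeps the series convergent for negative [c], so that its
   sum is continuous on the whole line, as the intermediate value theorem
   [IVT_gen] requires. *)
Definition truncate (eta : nat -> R) (c : R) (n : nat) : R :=
  Rmin (eta n) (Rabs c).

Lemma truncate_bounds (eta : nat -> R) (c : R) (n : nat) :
  0 <= eta n -> 0 <= truncate eta c n <= eta n.
Proof.
  intros H. unfold truncate. split.
  - apply Rmin_glb; [exact H | apply Rabs_pos].
  - apply Rmin_l.
Qed.

Lemma ex_series_truncate (eta : nat -> R) (c : R) :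
  (forall n, 0 <= eta n) -> ex_series eta -> ex_series (truncate eta c).
Proof.
  intros Hpos Hex. apply (ex_series_le_pos _ eta Hex).
  intros n. now apply truncate_bounds.
Qed.

(** Both the absolute value and the minimum with a fixed number are 1-Lipschitz. *)
Lemma truncate_lipschitz (eta : nat -> R) (c d : R) (n : nat) :
  Rabs (truncate eta c n - truncate eta d n) <= Rabs (c - d).
Proof.
  apply Rle_trans with (Rabs (Rabs c - Rabs d)); [|apply Rabs_triang_inv2].
  unfold truncate, Rmin. generalize (Rabs c) (Rabs d). intros x y.
  destruct (Rle_dec (eta n) x), (Rle_dec (eta n) y); split_Rabs; lra.
Qed.

(** Both truncations lie in [[0, eta n]]. This gives a summable bound independent of the heights. *)
Lemma truncate_dist_le (eta : nat -> R) (c d : R) (n : nat) :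
  0 <= eta n -> Rabs (truncate eta c n - truncate eta d n) <= eta n.
Proof.
  intros H.
  pose proof (truncate_bounds eta c n H). pose proof (truncate_bounds eta d n H).
  apply Rabs_le. lra.
Qed.

(** Split at [N]: the Lipschitz bound serves for the first [N] terms, domination by [eta] for the
    rest. *)
Lemma Series_truncate_dist (eta : nat -> R) (c d : R) (N : nat) :
  (forall n, 0 <= eta n) -> ex_series eta ->
  Rabs (Series (truncate eta c) - Series (truncate eta d))
    <= INR N * Rabs (c - d) + tail_sum eta N.
Proof.
  intros Hpos Hex.
  set (h := fun n => Rabs (truncate eta c n - truncate eta d n)).
  assert (Hh : ex_series h).
  { apply (ex_series_le_pos _ eta Hex). intros n. split.
    - apply Rabs_pos.
    - now apply truncate_dist_le. }
  rewrite <- Series_minus by now apply ex_series_truncate.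
  apply Rle_trans with (Series h); [now apply Series_Rabs|].
  apply Rle_trans with (INR N * Rabs (c - d) + tail_sum h N).
  - apply Series_le_head_tail; [exact Hh|].
    intros j _. apply truncate_lipschitz.
  - apply Rplus_le_compat_l. apply tail_sum_le; [exact Hex|].
    intros j _. split; [apply Rabs_pos | now apply truncate_dist_le].
Qed.

(** Choose [N] so that the tail of [eta] is below [eps / 2], then take the heights so close that the
    first [N] terms contribute at most [eps / 2]. *)
Lemma continuity_Series_truncate (eta : nat -> R) :
  (forall n, 0 <= eta n) -> ex_series eta ->
  continuity (fun c => Series (truncate eta c)).
Proof.
  intros Hpos Hex c eps Heps.
  destruct (proj2 (is_lim_seq_spec _ _) (is_lim_tail_sum eta Hex)
              (mkposreal (eps / 2) ltac:(lra))) as [N HN].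
  specialize (HN N (Nat.le_refl N)). simpl in HN.
  rewrite Rminus_0_r in HN. apply Rabs_def2 in HN.
  pose proof (pos_INR N) as HN0.
  (* The [+ 1] keeps the denominator positive when [N] is 0. *)
  exists (eps / 2 / (INR N + 1)). split.
  - apply Rdiv_lt_0_compat; lra.
  - intros d [_ Hd]. simpl in *. unfold Rdist in *.
    apply Rle_lt_trans with (1 := Series_truncate_dist eta d c N Hpos Hex).
    apply (Rmult_lt_compat_r (INR N + 1)) in Hd; [|lra].
    replace (eps / 2 / (INR N + 1) * (INR N + 1)) with (eps / 2) in Hd
      by (field; lra).
    pose proof (Rabs_pos (d - c)). lra.
Qed.

(** Height 0 gives the zero sequence and height [eta 0] gives [eta] itself; the sum takes every
    value in between by continuity. *)
Lemma exists_truncate_Series (eta : nat -> R) (s : R) :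
  l1_star eta -> 0 <= s <= Series eta ->
  exists c, 0 <= c /\ Series (truncate eta c) = s.
Proof.
  intros [[Hpos [Hdec _]] Hex] Hs.
  assert (H0 : Series (truncate eta 0) = 0).
  (* Zero is written as a product so that [Series_scal_l] can pull out the factor 0. *)
  { rewrite (Series_ext _ (fun _ => 0 * 0)).
    - rewrite Series_scal_l. lra.
    - intros n. unfold truncate. rewrite Rabs_R0, Rmin_right; [lra | apply Hpos]. }
  assert (H1 : Series (truncate eta (eta 0%nat)) = Series eta).
  { apply Series_ext. intros n. unfold truncate.
    rewrite Rabs_pos_eq by apply Hpos.
    apply Rmin_left. apply decreasing_prop; [exact Hdec | lia]. }
  destruct (IVT_gen (fun c => Series (truncate eta c)) 0 (eta 0%nat) s)
    as [c [Hc Hsum]].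
  - now apply continuity_Series_truncate.
  - rewrite H0, H1, Rmin_left, Rmax_right; lra.
  - exists c. split; [|exact Hsum].
    rewrite Rmin_left in Hc by apply Hpos. apply Hc.
Qed.

Lemma l1_star_truncate (eta : nat -> R) (c : R) :
  l1_star eta -> l1_star (truncate eta c).
Proof.
  intros [[Hpos [Hdec Hlim]] Hex].
  split; [split; [|split]|].
  - intros n. now apply truncate_bounds.
  - intros n. apply Rle_min_compat_r. apply Hdec.
  - apply is_lim_seq_le_le with (fun _ => 0) eta;
      [|apply is_lim_seq_const | exact Hlim].
    intros n. now apply truncate_bounds.
  - now apply ex_series_truncate.
Qed.

Lemma tail_sum_le_truncate (xi eta : nat -> R) (c : R) :
  l1_star xi -> l1_star eta ->
  (forall n, tail_sum xi n <= tail_sum eta n) ->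
  0 <= c -> Series (truncate eta c) = Series xi ->
  forall n, tail_sum xi n <= tail_sum (truncate eta c) n.
Proof.
  intros [[Hxpos [Hxdec _]] Hxex] Heta Hle Hc Hsum.
  pose proof (proj2 (l1_star_truncate eta c Heta)) as Hzex.
  destruct Heta as [[Hepos [Hedec Helim]] Heex].
  assert (Habs : Rabs c = c) by now apply Rabs_pos_eq.
  assert (Hlarge : forall n, c <= xi n ->
            tail_sum xi n <= tail_sum (truncate eta c) n).
  { intros n Hn.
    assert (Hx : INR n * c + tail_sum xi n <= Series xi).
    { apply Series_ge_head_tail; [exact Hxex|].
      intros j Hj. apply Rle_trans with (1 := Hn).
      apply decreasing_prop; [exact Hxdec | lia]. }
    assert (Hz : Series (truncate eta c)
                   <= INR n * c + tail_sum (truncate eta c) n).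
    { apply Series_le_head_tail; [exact Hzex|].
      intros j _. unfold truncate. rewrite Habs. apply Rmin_r. }
    lra. }
  assert (Hsmall : forall n, eta n <= c ->
            tail_sum xi n <= tail_sum (truncate eta c) n).
  { intros n Hn. apply Rle_trans with (1 := Hle n).
    apply tail_sum_le; [exact Hzex|].
    intros j Hj. split; [apply Hepos|].
    unfold truncate. rewrite Habs. apply Rmin_glb; [lra|].
    apply Rle_trans with (2 := Hn). now apply decreasing_prop. }
  (* Induction on the distance [k] to an index where [eta] is at most [c]. *)
  assert (Hdown : forall k n, eta (n + k)%nat <= c ->
            tail_sum xi n <= tail_sum (truncate eta c) n).
  { induction k as [|k IH]; intros n Hk.
    - apply Hsmall. now rewrite Nat.add_0_r in Hk.
    - destruct (Rle_dec c (xi n)) as [Hx|Hx]; [now apply Hlarge|].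
      destruct (Rle_dec (eta n) c) as [He|He]; [now apply Hsmall|].
      rewrite (tail_sum_step xi n Hxex), (tail_sum_step _ n Hzex).
      apply Rplus_le_compat.
      + unfold truncate. rewrite Habs, Rmin_right; lra.
      + apply IH. now replace (S n + k)%nat with (n + S k)%nat by lia. }
  intros n.
  (* For [c = 0] the sequence [eta] may never come down to [c], but then [c <= xi n] always holds.
     For [c > 0] the limit of [eta] supplies the starting index. *)
  destruct (Rle_dec c 0) as [Hc0|Hc0].
  - apply Hlarge. specialize (Hxpos n). lra.
  - destruct (proj2 (is_lim_seq_spec _ _) Helim
                (mkposreal c ltac:(lra))) as [N HN].
    apply (Hdown N). specialize (HN (n + N)%nat ltac:(lia)). simpl in HN.
    rewrite Rminus_0_r in HN. apply Rabs_def2 in HN. lra.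
Qed.

(** * Raising the first term *)

Definition add_first (a : nat -> R) (d : R) (n : nat) : R :=
  match n with O => a O + d | S _ => a n end.

Lemma ex_series_add_first (a : nat -> R) (d : R) :
  ex_series a -> ex_series (add_first a d).
Proof.
  intros Ha. apply ex_series_incr_1.
  now apply (proj1 (ex_series_incr_1 a)).
Qed.

Lemma Series_add_first (a : nat -> R) (d : R) :
  ex_series a -> Series (add_first a d) = Series a + d.
Proof.
  intros Ha.
  rewrite (Series_incr_1 a Ha), (Series_incr_1 _ (ex_series_add_first a d Ha)).
  simpl. lra.
Qed.

(** Increasing the largest term preserves sign and monotonicity; the limit and summability do not
    depend on one term. *)
Lemma l1_star_add_first (a : nat -> R) (d : R) :
  0 <= d -> l1_star a -> l1_star (add_first a d).
Proof.
  intros Hd [[Hpos [Hdec Hlim]] Hex].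
  split; [split; [|split]|].
  - intros [|n]; simpl; [pose proof (Hpos 0%nat); lra | apply Hpos].
  - intros [|n]; simpl; [pose proof (Hdec 0%nat); lra | apply Hdec].
  - apply is_lim_seq_incr_1. now apply (proj1 (is_lim_seq_incr_1 a 0)).
  - now apply ex_series_add_first.
Qed.

Theorem theorem7p7 :
  forall xi eta : nat -> R,
    l1_star xi -> l1_star eta -> prec_infty xi eta ->
    (exists zeta : nat -> R,
        co_star zeta /\ preceq_infty xi zeta /\ seq_le zeta eta) /\
    (exists rho : nat -> R,
        co_star rho /\ seq_le xi rho /\ preceq_infty rho eta).
Proof.
  intros xi eta Hxi Heta [_ [_ Hle]].
  pose proof (Hle 0%nat) as Htot. rewrite !tail_sum_0 in Htot.
  split.
  - assert (Hs : 0 <= Series xi <= Series eta).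
    { split; [|exact Htot].
      replace 0 with (Series (fun _ => 0 * 0)) by (rewrite Series_scal_l; lra).
      apply Series_le; [|apply Hxi].
      intros n. pose proof (proj1 (proj1 Hxi) n). lra. }
    destruct (exists_truncate_Series eta (Series xi) Heta Hs) as [c [Hc Hsum]].
    pose proof (l1_star_truncate eta c Heta) as Hz.
    exists (truncate eta c). split; [apply Hz|]. split.
    + split; [|now symmetry].
      split; [exact Hxi|]. split; [exact Hz|].
      now apply tail_sum_le_truncate.
    + intros n. apply Rmin_l.
  - set (d := Series eta - Series xi).
    assert (Hd : 0 <= d) by (unfold d; lra).
    pose proof (l1_star_add_first xi d Hd Hxi) as Hr.
    assert (Hsum : Series (add_first xi d) = Series eta).
    { rewrite Series_add_first by apply Hxi. unfold d. lra. }
    exists (add_first xi d). split; [apply Hr|]. split.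
    + intros [|n]; simpl; lra.
    + split; [|exact Hsum].
      split; [exact Hr|]. split; [exact Heta|].
      intros [|n].
      * rewrite !tail_sum_0. lra.
      (* From index 1 on, the tails of [add_first xi d] are those of [xi] by computation. *)
      * exact (Hle (S n)).
Qed.
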